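(* Let $a,b,\mu\in\mathbb{N}^{+}$ be positive integers with $a,b>1$, $\gcd(a-1,\mu)=1$ and $\gcd(b-1,\mu)=1$. Then the sequence $n\mapsto T(K_n;a,b)$ is ultimately periodic modulo $\mu$, where $T$ is the Tutte polynomial and $K_n$ is the complete graph on $n$ vertices.
   Context: For a finite graph $G=(V(G),E(G))$ and $A\subseteq E(G)$, let $\kappa(A)$ be the number of connected components of the spanning subgraph $(V(G),A)$, and let $\kappa(G)=\kappa(E(G))$. The Tutte polynomial is $$T(G;X,Y)=\sum_{A\subseteq E(G)}(X-1)^{\kappa(A)-\kappa(G)}\,(Y-1)^{|A|+\kappa(A)-|V(G)|}.$$ An integer sequence $(s_n)_{n\ge 1}$ is ultimately periodic modulo $\mu$ if there exist $N\ge 1$ and $p\ge 1$ such that $s_{n+p}\equiv s_n \pmod{\mu}$ for all $n\ge N$. *)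

(* Defs.v *)
From mathcomp Require Import all_boot all_order all_algebra.

Set Implicit Arguments.
Unset Strict Implicit.
Unset Printing Implicit Defensive.

Import Order.TTheory GRing.Theory Num.Theory.

Record graph := Graph {
  vertex : finType;
  edges : {set {set vertex}};
  edges_card2 : forall e, e \in edges -> #|e| = 2
}.

Definition adj (V : finType) (A : {set {set V}}) : rel V :=
  fun x y => [set x; y] \in A.

Definition kappa (V : finType) (A : {set {set V}}) : nat := n_comp (adj A) V.

Local Open Scope ring_scope.

(* The exponents never truncate: kappa A >= kappa (edges G) and
   #|A| + kappa A >= #|vertex G| for every A \subset edges G. *)
Definition tutte (G : graph) : {poly {poly int}} :=
  \sum_(A : {set {set vertex G}} | A \subset edges G)
    ('X - 1) ^+ (kappa A - kappa (edges G))
    * ('Y - 1) ^+ (#|A| + kappa A - #|vertex G|).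

(* In polyXY, u.[x, y] is u.[x%:P].[y]: outer variable 'X at x, 'Y at y. *)
Definition tutte_at (G : graph) (a b : int) : int := (tutte G).[a, b].

Definition complete_edges (n : nat) : {set {set 'I_n}} :=
  [set e : {set 'I_n} | #|e| == 2].

Lemma complete_edges_card2 (n : nat) (e : {set 'I_n}) :
  e \in complete_edges n -> #|e| = 2.
Proof. by rewrite inE => /eqP. Qed.

Definition complete_graph (n : nat) : graph :=
  Graph (@complete_edges_card2 n).

(* Sequences are indexed by n >= 1: the value s 0 is never used. *)
Definition ultimately_periodic_mod (mu : nat) (s : nat -> int) : Prop :=
  exists N p : nat, [/\ (1 <= N)%N, (1 <= p)%N &
    forall n : nat, (N <= n)%N -> (s (n + p)%N = s n %[mod mu%:Z])%Z].

(* Main.v *)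
Require Import Defs.
From mathcomp Require Import all_boot all_order all_algebra.
From mathcomp Require Import zify ring.

(** Put x = a - 1, y = b - 1 and q = x y.  Since x and y are invertible modulo
    mu, it suffices to study x y^n T(K_n; a, b), which by Fortuin and Kasteleyn
    is the Potts partition function: the sum over colourings s : [n] -> [q] of
    b^(number of monochromatic edges).  Weight each vertex of colour c by w c,
    for w : [q] -> Z/mu.  Conditioning on the colour c of one vertex gives
    W_(n+1)(w) = sum_c w(c) W_n(w with w(c) replaced by b w(c)),
    so the function W_n, an element of a finite set, is obtained by iterating a
    fixed map and is ultimately periodic.  The constant weight y^-1 supplies the
    factor y^-n. *)

Set Implicit Arguments.
Unset Strict Implicit.
Unset Printing Implicit Defensive.

Import Order.TTheory GRing.Theory Num.Theory.

(** * Colourings, components and the Fortuin-Kasteleyn identity *)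

Section Colourings.

Variable V : finType.
Implicit Types (A E : {set {set V}}) (e : {set V}).

(** Stated for an arbitrary vertex set, so that no endpoints of an edge have to be chosen. *)
Definition mono (C : finType) (s : {ffun V -> C}) e : bool :=
  [forall x in e, forall y in e, s x == s y].

Lemma mono_pair (C : finType) (s : {ffun V -> C}) x y :
  mono s [set x; y] = (s x == s y).
Proof.
apply/idP/idP => [/forall_inP/(_ x)|/eqP sxy].
  by rewrite !inE eqxx => /(_ isT)/forall_inP/(_ y); rewrite !inE eqxx orbT; apply.
apply/forall_inP => u; rewrite !inE => /orP[]/eqP->;
  by apply/forall_inP => v; rewrite !inE => /orP[]/eqP->; rewrite ?sxy.
Qed.

Lemma adj_sym A : symmetric (adj A).
Proof. by move=> x y; rewrite /adj setUC. Qed.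

Lemma connect_adj_sym A : connect_sym (adj A).
Proof. by apply: sym_connect_sym; apply: adj_sym. Qed.

Definition invariant (C : finType) A (s : {ffun V -> C}) : bool :=
  [forall x, forall y, adj A x y ==> (s x == s y)].

Lemma invariantP (C : finType) A (s : {ffun V -> C}) :
  reflect (forall x y, adj A x y -> s x = s y) (invariant A s).
Proof.
apply: (iffP forallP) => [H x y Axy|H x].
  by have /forallP/(_ y)/implyP/(_ Axy)/eqP := H x.
by apply/forallP => y; apply/implyP => /H ->.
Qed.

Lemma invariant_mono (C : finType) A (s : {ffun V -> C}) :
    (forall e, e \in A -> #|e| = 2) ->
  invariant A s = [forall e in A, mono s e].
Proof.
move=> A2; apply/invariantP/forall_inP => [H e eA|H x y /H].
  have /cards2P[x [y [_ e_xy]]] : #|e| == 2 by rewrite A2.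
  by rewrite e_xy mono_pair; apply/eqP/H; rewrite /adj -e_xy.
by rewrite mono_pair => /eqP.
Qed.

Lemma invariant_connect (C : finType) A (s : {ffun V -> C}) x y :
  invariant A s -> connect (adj A) x y -> s x = s y.
Proof.
move=> /invariantP inv /connectP[p]; elim: p x => [x _ ->//|z p IH x /=].
by case/andP => /inv -> /IH H /H.
Qed.

(** An invariant colouring is a free choice of colour at the root of each component: [f] spreads
    such a choice over the components. *)
Lemma card_invariant (C : finType) A :
  #|[set s : {ffun V -> C} | invariant A s]| = #|C| ^ kappa A.
Proof.
pose r := fingraph.root (adj A); have sA := connect_adj_sym A.
pose rr x : {x | roots (adj A) x} := Sub (r x) (roots_root sA x).
pose f (g : {ffun {x | roots (adj A) x} -> C}) := [ffun x => g (rr x)].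
have rrK u : rr (val u) = u.
  by apply: val_inj; rewrite /= /r (eqP (valP u)).
have f_inj : injective f.
  move=> g h /ffunP eq_gh; apply/ffunP => u.
  by have := eq_gh (val u); rewrite !ffunE rrK.
have -> : [set s : {ffun V -> C} | invariant A s] = [set f g | g in setT].
  apply/setP => s; rewrite inE; apply/idP/imsetP => [inv|[g _ ->]].
    exists [ffun u => s (val u)] => //; apply/ffunP => x; rewrite !ffunE /=.
    exact: invariant_connect inv (connect_root _ _).
  apply/invariantP => x y /connect1; rewrite !ffunE -(root_connect sA) => /eqP rxy.
  by congr (g _); apply: val_inj.
rewrite card_imset // cardsT card_ffun card_sig; congr (_ ^ _).
by apply: eq_card => x; rewrite !inE andbT.
Qed.

(* The set of edges of A cut by a two-colouring determines the colouring up to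
   adding an A-invariant one, so 2^|V| <= 2^|A| 2^(kappa A). *)
Lemma leq_card_vertex_kappa A :
  (forall e, e \in A -> #|e| = 2) -> #|V| <= #|A| + kappa A.
Proof.
move=> A2; rewrite -(leq_exp2l _ _ (isT : 1 < 2)) expnD -{1 3}card_bool.
rewrite -card_invariant -card_ffun -card_powerset -[X in X <= _]sum1_card.
pose cut (s : {ffun V -> bool}) := [set e in A | ~~ mono s e].
rewrite (partition_big cut (mem (powerset A))) /=; last first.
  by move=> s _; rewrite inE; apply/subsetP => e; rewrite inE => /andP[].
rewrite -sum_nat_const; apply: leq_sum => B _; rewrite sum1_card.
have [s0 /eqP cut0|no_s] := pickP [pred s | cut s == B]; last first.
  by rewrite eq_card0 // => s; have := no_s s; rewrite !inE.
pose t (s : {ffun V -> bool}) := [ffun x => s x (+) s0 x].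
have t_inj : injective t.
  move=> s1 s2 /ffunP E; apply/ffunP => x; have := E x; rewrite !ffunE.
  exact: addIb.
rewrite -(card_image t_inj); apply/subset_leq_card/subsetP => _ /imageP[s + ->].
rewrite -[s \in _]/(cut s == B) -cut0 => /eqP/setP eq_cut; rewrite inE.
apply/invariantP => x y Axy; have := eq_cut [set x; y].
rewrite !inE !mono_pair !ffunE; move: Axy; rewrite /adj => -> /=.
by case: (s x); case: (s y); case: (s0 x); case: (s0 y).
Qed.

Lemma kappa_gt0 A : V -> 0 < kappa A.
Proof.
move=> x; apply/card_gt0P; exists (fingraph.root (adj A) x).
by rewrite !inE roots_root //; apply: connect_adj_sym.
Qed.

Local Open Scope ring_scope.

(** Both sides sum y^|A| over the pairs (A, s) with s constant on the components of A: summing over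
    s first gives the left side, expanding the product over edges gives the right. *)
Lemma fortuin_kasteleyn (R : comNzRingType) (C : finType) E (y : R) :
    (forall e, e \in E -> #|e| = 2) ->
  \sum_(A : {set {set V}} | A \subset E) #|C|%:R ^+ kappa A * y ^+ #|A| =
  \sum_(s : {ffun V -> C}) \prod_(e in E) (if mono s e then 1 + y else 1).
Proof.
move=> E2.
transitivity (\sum_(A : {set {set V}} | A \subset E)
    \sum_(s : {ffun V -> C}) (invariant A s)%:R * y ^+ #|A|).
  apply: eq_bigr => A AE; rewrite -mulr_suml -natrX -card_invariant; congr (_ * _).
  rewrite -sum1_card natr_sum big_mkcond /=; apply: eq_bigr => s _.
  by rewrite inE; case: invariant.
rewrite exchange_big; apply: eq_bigr => s _ /=.
(* Extending by 0 lets the product range over all vertex sets; its expansion keeps only the A inside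
   E whose edges are all monochromatic. *)
pose c e := if (e \in E) && mono s e then y else 0.
transitivity (\prod_e (c e + 1)); last first.
  rewrite [RHS]big_mkcond; apply: eq_bigr => e _; rewrite /c.
  by case: (e \in E) => //=; case: (mono s e); rewrite ?add0r // addrC.
rewrite bigA_distr big_mkcond; apply: eq_bigr => A _ /=.
rewrite -big_mkcond /=; case: ifP => [AE|/negbT/subsetPn[e eA eE]]; last first.
  by rewrite (bigD1 e) //= /c (negPf eE) mul0r.
have A2 e : e \in A -> #|e| = 2 by move=> /(subsetP AE)/E2.
rewrite invariant_mono //; case: forall_inP => [H|/forall_inP].
  rewrite mul1r -prodr_const; apply: eq_bigr => e eA.
  by rewrite /c (subsetP AE) //= H.
rewrite negb_forall_in => /exists_inP[e eA /negPf ne].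
by rewrite mul0r (bigD1 e) //= /c ne andbF mul0r.
Qed.

End Colourings.

(** * Components and edges of the complete graph *)

Lemma kappa_complete n : kappa (complete_edges n.+1) = 1.
Proof.
rewrite /kappa -(n_comp_connect (connect_adj_sym (complete_edges n.+1)) ord0).
apply: eq_n_comp_r => x; rewrite [LHS]inE; apply/esym.
have [->|x0] := eqVneq x ord0; first exact: connect0.
(* Vertex 0 is joined to every other vertex. *)
by apply: connect1; rewrite /adj inE cards2 [ord0 == x]eq_sym x0.
Qed.

Local Open Scope ring_scope.

(** Ordering endpoints makes the edges at vertex 0 the first row of a double product, ready to be
    split off. *)
Lemma prod_complete_edges (R : comNzRingType) n (F : {set 'I_n} -> R) :
  \prod_(e in complete_edges n) F e =
  \prod_(i < n) \prod_(j < n | (i < j)%N) F [set i; j].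
Proof.
rewrite pair_big_dep /=.
have -> : complete_edges n =
    [set [set p.1; p.2] | p in [pred p : 'I_n * 'I_n | (p.1 < p.2)%N]].
  apply/setP => e; rewrite inE; apply/cards2P/imsetP => [[x [y [nxy ->]]]|].
    have [lt|lt|/val_inj/eqP] := ltngtP x y; last by rewrite (negPf nxy).
      by exists (x, y).
    by exists (y, x); rewrite //= setUC.
  case=> -[x y]; rewrite inE /= => lt ->; exists x, y; split=> //.
  by rewrite -val_eqE neq_ltn /= lt.
rewrite big_imset //= => -[x y] [u v]; rewrite !inE /= => xy uv /setP E.
have := E x; have := E y; have := E u; have := E v.
rewrite !inE !eqxx /= ?orbT -!val_eqE /= => E1 E2 E3 E4.
by congr pair; apply: val_inj => /=; lia.
Qed.

(** * The weighted Potts sum and its recursion *)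

Section Potts.

Variables (R : comNzRingType) (C : finType) (b : R).

Definition potts n (w : {ffun C -> R}) : R :=
  \sum_(s : {ffun 'I_n -> C})
    (\prod_(e in complete_edges n) (if mono s e then b else 1))
    * \prod_i w (s i).

(** Absorbs the edge from a removed vertex of colour c into the weight of its other endpoint. *)
Definition bump_weight (w : {ffun C -> R}) (c : C) : {ffun C -> R} :=
  [ffun d => (if c == d then b else 1) * w d].

Lemma pottsS n w : potts n.+1 w = \sum_c w c * potts n (bump_weight w c).
Proof.
pose ext (p : C * {ffun 'I_n -> C}) : {ffun 'I_n.+1 -> C} :=
  [ffun i => if unlift ord0 i is Some j then p.2 j else p.1].
pose res (s : {ffun 'I_n.+1 -> C}) : C * {ffun 'I_n -> C} :=
  (s ord0, [ffun j => s (lift ord0 j)]).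
have extK : cancel ext res.
  move=> [c s]; rewrite /res /ext !ffunE unlift_none; congr pair.
  by apply/ffunP => j; rewrite !ffunE liftK.
have resK : cancel res ext.
  move=> s; apply/ffunP => i; rewrite ffunE.
  by case: unliftP => [j|] -> //=; rewrite ffunE.
rewrite /potts (reindex ext) /=; last first.
  by exists res => ? _; [apply: extK | apply: resK].
under [RHS]eq_bigr do rewrite mulr_sumr.
rewrite pair_big /=; apply: eq_bigr => -[c s] _ /=.
have ext0 : ext (c, s) ord0 = c by rewrite ffunE unlift_none.
have extS j : ext (c, s) (lift ord0 j) = s j by rewrite ffunE liftK.
rewrite !prod_complete_edges !big_ord_recl ext0.
rewrite [X in X * _ * _ = _]big_mkcond big_ord_recl /= mul1r.
under eq_bigr do rewrite mono_pair ext0 extS.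
(* The remaining rows avoid vertex 0 and form the edge product of the complete graph on the other n
   vertices. *)
rewrite [X in _ * X * _ = _](_ : _ =
   \prod_(i < n) \prod_(j < n | (i < j)%N) (if mono s [set i; j] then b else 1));
  last first.
  apply: eq_bigr => i _; rewrite big_mkcond big_ord_recl /= mul1r -big_mkcond /=.
  by apply: eq_big => // j _; rewrite !mono_pair !extS.
under [X in _ * (w c * X) = _]eq_bigr do rewrite extS.
under [X in w c * (_ * X)]eq_bigr do rewrite ffunE.
by rewrite big_split /=; ring.
Qed.

End Potts.

(** * Ultimate periodicity by iteration on a finite set *)

Lemma iter_ultimately_periodic (T : finType) (f : T -> T) (x : T) :
  exists N p : nat, [/\ (1 <= N)%N, (1 <= p)%N &
    forall n : nat, (N <= n)%N -> iter (n + p) f x = iter n f x].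
Proof.
(* The iterate of index [order f x] repeats an earlier one, of index [i]; the threshold is [i.+1]
   only to be positive. *)
have /loopingP/(_ (order f x))/trajectP[i i_lt eq_i] := looping_order f x.
exists i.+1, (order f x - i)%N; split; rewrite ?subn_gt0 // => n /ltnW i_n.
rewrite -{1}(subnK i_n) -addnA subnKC; last exact: ltnW.
by rewrite iterD eq_i -iterD subnK.
Qed.

Lemma potts_ultimately_periodic (R : finComNzRingType) (C : finType) (b : R)
    (w : {ffun C -> R}) :
  exists N p : nat, [/\ (1 <= N)%N, (1 <= p)%N &
    forall n : nat, (N <= n)%N -> potts b (n + p) w = potts b n w].
Proof.
(* The recursion changes the weight, so the state is the whole function of the weight. *)
pose next (P : {ffun {ffun C -> R} -> R}) : {ffun {ffun C -> R} -> R} :=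
  [ffun v : {ffun C -> R} => \sum_c v c * P (bump_weight b v c)].
have pottsE n : [ffun v => potts b n v] = iter n next [ffun v => potts b 0 v].
  elim: n => //= n <-; apply/ffunP => v; rewrite /next !ffunE pottsS.
  by apply: eq_bigr => c _; rewrite ffunE.
have [N [p [N1 p1 per]]] := iter_ultimately_periodic next [ffun v => potts b 0 v].
exists N, p; split=> // n /per; rewrite -!pottsE => /ffunP/(_ w).
by rewrite !ffunE.
Qed.

(** * From Potts sums back to the Tutte polynomial *)

Lemma potts_const (R : comNzRingType) (C : finType) (b v : R) n :
  potts b n [ffun _ : C => v] =
  v ^+ n * \sum_(s : {ffun 'I_n -> C})
    \prod_(e in complete_edges n) (if mono s e then b else 1).
Proof.
rewrite mulr_sumr; apply: eq_bigr => s _; rewrite mulrC; congr (_ * _).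
under eq_bigr do rewrite ffunE.
by rewrite prodr_const card_ord.
Qed.

(** Since K_n is connected, the factor x y^n turns each term x^(kappa A - 1) y^(|A| + kappa A - n)
    into (x y)^(kappa A) y^|A|. *)
Lemma tutte_complete_colourings (R : comNzRingType) x y n : (0 < n)%N ->
  (tutte_at (complete_graph n) x.+1 y.+1)%:~R * (x%:R * y%:R ^+ n) =
  \sum_(s : {ffun 'I_n -> 'I_(x * y)})
    \prod_(e in complete_edges n) (if mono s e then y.+1%:R else 1) :> R.
Proof.
case: n => // n _; have C2 := @complete_edges_card2 n.+1.
rewrite -natr1 addrC -fortuin_kasteleyn // card_ord.
rewrite /tutte_at /tutte !horner_sum rmorph_sum mulr_suml /=.
apply: eq_bigr => A AE; rewrite kappa_complete card_ord.
have A2 e : e \in A -> #|e| = 2 by move=> /(subsetP AE)/C2.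
(* This bound and the next make the truncated subtractions in the exponents exact. *)
have k_gt0 : (0 < kappa A)%N by apply: kappa_gt0; apply: ord0.
have := leq_card_vertex_kappa A2; rewrite card_ord => n_le.
have predS (z : nat) : (z.+1 : int) - 1 = z by lia.
rewrite !hornerE !predS rmorphM !rmorphXn /= -!pmulrn -mulrA mulrACA.
by rewrite -exprSr -exprD subn1 prednK // subnK // natrM exprMn exprD mulrAC mulrA.
Qed.

Lemma eqz_mod_Zp (mu : nat) (m n : int) :
  (1 < mu)%N -> m%:~R = n%:~R :> 'Z_mu -> (m = n %[mod mu])%Z.
Proof.
move=> mu1 /eqP; rewrite -subr_eq0 -intrB => /eqP mn0; apply/eqP.
rewrite eqz_mod_dvd dvdzE absz_nat; move: (m - n) mn0 => z z0.
(* [|z|] is [z] up to sign, so it vanishes too, and [val_Zp_nat] reads off its remainder. *)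
have : (`|z|%N)%:R = 0 :> 'Z_mu.
  by rewrite -[RHS](mulr0 ((-1) ^+ (z < 0)%R)) -z0 {3}[z]intEsign rmorphM /=
     rmorph_sign mulrA -signr_addb addbb mul1r.
by move/(congr1 val); rewrite /= val_Zp_nat // => /eqP.
Qed.

Local Close Scope ring_scope.

Theorem theorem1p5 (a b mu : nat) (mu_gt0 : 0 < mu)
    (a_gt1 : 1 < a) (b_gt1 : 1 < b)
    (coprime_a : gcdn (a - 1) mu = 1) (coprime_b : gcdn (b - 1) mu = 1) :
  ultimately_periodic_mod mu
    (fun n : nat => tutte_at (complete_graph n) (Posz a) (Posz b)).
Proof.
(* ['Z_mu] is the ring of integers modulo [mu] only for [mu > 1]: ['Z_1] has two elements. *)
have [mu1|mu_le1] := ltnP 1 mu; last first.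
  have -> : mu = 1 by lia.
  by exists 1, 1; split=> // n _; rewrite !modz1.
Local Open Scope ring_scope.
case: a b a_gt1 b_gt1 coprime_a coprime_b => // x [//|y] _ _.
rewrite !subn1 /= => cox coy.
have xU : x%:R \is a @GRing.unit 'Z_mu by rewrite unitZpE // coprime_sym /coprime cox.
have yU : y%:R \is a @GRing.unit 'Z_mu by rewrite unitZpE // coprime_sym /coprime coy.
have tutteE n : (0 < n)%N -> (tutte_at (complete_graph n) x.+1 y.+1)%:~R
    = x%:R^-1 * potts y.+1%:R n [ffun _ : 'I_(x * y) => y%:R^-1] :> 'Z_mu.
  move=> n_gt0; rewrite potts_const -tutte_complete_colourings // exprVn.
  by rewrite mulrA [_ * _ ^+ n]mulrC mulKr ?unitrX // mulrC mulrK.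
have [N [p [N1 p1 per]]] := potts_ultimately_periodic (y.+1%:R : 'Z_mu)
   [ffun _ : 'I_(x * y) => y%:R^-1].
exists N, p; split=> // n Nn; have n_gt0 := leq_trans N1 Nn.
by apply: eqz_mod_Zp; rewrite // !tutteE ?per // ltn_addr.
Qed.
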